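(* Let $\gamma\ge 2$ be an integer and let $G$ be a connected graph with maximum degree $\Delta\ge 3$ and girth $g(G)\ge 2\gamma+2$. Put $M=\Delta\frac{(\Delta-1)^{\gamma}-1}{\Delta-2}$. If either (i) $\gamma\ge 3$ and $\kappa(G)\ge 3$, or (ii) $\gamma=2$, $\kappa(G)\ge 4$ and $g(G)>6$, then $\chi_\gamma(G)\le M-1$.
   Context: Graphs are finite and simple. The $\gamma$-th power $G^\gamma$ of $G$ is the graph on the vertex set of $G$ in which two distinct vertices are adjacent if and only if their distance in $G$ is at most $\gamma$. $\chi_\gamma(G):=\chi(G^\gamma)$ is the chromatic number of $G^\gamma$. The girth $g(G)$ is the length of a shortest cycle, with $g(G)=+\infty$ if $G$ has no cycles. $\kappa(G)$ is the (vertex) connectivity of $G$. *)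

(* Defs.v *)
From mathcomp Require Import all_boot all_order all_algebra.
Set Implicit Arguments.
Unset Strict Implicit.
Unset Printing Implicit Defensive.

(* Extended natural numbers: None is +oo. *)
Definition enat := option nat.

Definition enat_le (a b : enat) : bool :=
  match a, b with
  | _, None => true
  | None, Some _ => false
  | Some m, Some n => m <= n
  end.

Definition enat_lt (a b : enat) : bool := ~~ enat_le b a.

(* The least k <= N satisfying P, and +oo if there is none. *)
Definition least_upto (N : nat) (P : pred nat) : enat :=
  ohead [seq k <- iota 0 N.+1 | P k].

(* A finite simple graph is a symmetric irreflexive relation on a finType. *)
Section Graph.
Variables (T : finType) (e : rel T).

Definition simple_graph : Prop := symmetric e /\ irreflexive e.

(* The empty graph is not connected. *)
Definition connected_graph : bool :=
  (0 < #|T|) && [forall x, forall y, connect e x y].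

Definition max_degree : nat := \max_(x : T) #|[set y | e x y]|.

Definition walk_of_length (x y : T) (k : nat) : bool :=
  [exists p : k.-tuple T, path e x p && (last x p == y)].

(* A shortest walk repeats no vertex, so its length is less than #|T|: the
   bound on the search loses nothing. *)
Definition gdist (x y : T) : enat := least_upto #|T| (walk_of_length x y).

Definition graph_power (gamma : nat) : rel T :=
  [rel x y | (x != y) && enat_le (gdist x y) (Some gamma)].

(* ucycleb allows [:: x; y] with x adjacent to y, whence the bound 3 <= k. *)
Definition cycle_of_length (k : nat) : bool :=
  (3 <= k) && [exists c : k.-tuple T, ucycleb e c].

(* The vertices of a cycle are distinct, so its length is at most #|T|. *)
Definition girth : enat := least_upto #|T| cycle_of_length.

Definition colorable (k : nat) : bool :=
  [exists f : {ffun T -> 'I_k}, forall x, forall y, e x y ==> (f x != f y)].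

(* A loopless graph is #|T|-colorable, so the search range is not empty. *)
Definition chromatic_number : nat :=
  [arg min_(k < ord_max : 'I_#|T|.+1 | colorable k) (k : nat)].

Definition del_vertices (X : {set T}) : rel T :=
  [rel x y | [&& x \notin X, y \notin X & e x y]].

Definition k_connected (k : nat) : bool :=
  (k < #|T|) &&
  [forall X : {set T}, (#|X| < k) ==>
    [forall x in ~: X, forall y in ~: X, connect (del_vertices X) x y]].

(* The largest k such that the graph is k-connected; in particular a complete
   graph on n vertices has connectivity n - 1. *)
Definition connectivity : nat := \max_(k < #|T| | k_connected k) k.

End Graph.

Definition chromatic_power (T : finType) (e : rel T) (gamma : nat) : nat :=
  chromatic_number (graph_power e gamma).

(* Main.v *)
Require Import Defs.
From mathcomp Require Import all_boot all_order all_algebra.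
From mathcomp Require Import zify.
Import Order.TTheory GRing.Theory Num.Theory.
Set Implicit Arguments.
Unset Strict Implicit.
Unset Printing Implicit Defensive.

(** Counting the vertices of each sphere shows that a vertex of the power
    [G^gamma] has at most [M] neighbours ([power_degree_bound]).  Greedy
    colouring with [M - 1] colours therefore succeeds as soon as every vertex,
    when its turn comes, has two neighbours whose colours cost nothing: a
    neighbour is free if it is coloured later, or if its colour already occurs
    on another neighbour ([greedy_colorable]).

    Fix adjacent vertices [r] and [u] and a set [X] with [G - X] connected, and
    colour the vertices by decreasing distance to [r] in [G - X], with [u] last
    but one and [r] last.  The next two vertices on a shortest path to [r] are
    coloured later than the vertex itself, and the neighbours of [r] have both
    [u] and [r] coloured later.  Only [u], which needs one more free neighbour,
    and [r], which needs two, depend on a precolouring of a set [P] containing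
    [X] ([power_colorable_from_root]).  Repeated colours must be placed on
    vertices at distance more than [gamma]: by the girth hypothesis, the
    ends of a path of length [gamma + 1] are such vertices, since a shorter
    connection would close a cycle of length at most [2 gamma + 1]
    ([far_ends]).

    For [gamma = 2] one colour is given to a neighbour [a1] of [r], a neighbour
    [a2] of [u] and a neighbour [a3] of a third neighbour of [r].  Then [a2] and
    [a3] are joined by a path of length 4, and a cycle of length 6 could bring
    them to distance 2: hence the assumption that the girth exceeds 6.  All
    three vertices are deleted, which takes 4-connectivity
    ([square_colorable]).

    For [gamma >= 3], take a path of length [gamma] from [r], ending in [a2] and
    [b2]; a path [r, u, a1] and a neighbour [x] of [r] away from it.  The pair
    [a1], [a2] gets one colour and the pair [x], [b2] another.  Both pairs help
    [r] and the first helps [u].  Only the first pair is deleted, so that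
    3-connectivity is enough: a vertex far from [r] has three vertices within
    distance 3 ahead of it on its shortest path, and at most one of them is [x]
    or [b2], because these two are far apart ([power_colorable]). *)

(** * The search operator *)

Lemma least_upto_le N (P : pred nat) k :
  k <= N -> P k -> enat_le (least_upto N P) (Some k).
Proof.
move=> kN Pk; rewrite /least_upto.
have: k \in [seq i <- iota 0 N.+1 | P i] by rewrite mem_filter Pk mem_iota.
have: sorted leq [seq i <- iota 0 N.+1 | P i].
  by apply: sorted_filter; [exact: leq_trans | exact: iota_sorted].
case: [seq i <- iota 0 N.+1 | P i] => [//|k0 l] /= k0l.
rewrite inE => /predU1P[-> //|kl].
by have /allP/(_ _ kl) := order_path_min leq_trans k0l.
Qed.

Lemma least_upto_witness N (P : pred nat) n :
  enat_le (least_upto N P) (Some n) -> exists2 k, k <= n & P k.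
Proof.
rewrite /least_upto.
have: all P [seq i <- iota 0 N.+1 | P i] by apply: filter_all.
case: [seq i <- iota 0 N.+1 | P i] => [//|k0 l] /= /andP[Pk0 _] k0n.
by exists k0.
Qed.

(** * Greedy colouring with a precoloured set *)

(** A neighbour [s] of [v] in [S] whose colour costs nothing at the time when
    [v] is coloured.  The witness [t] is kept out of [S] so that the colours
    seen by [v] are those of its neighbours outside [S], whichever members of
    [S] repeat which colours. *)
Definition redundant (T : finType) (h : rel T) (C : Type) (P : {set T})
    (c0 : T -> C) (rank : T -> nat) (v : T) (S : {set T}) (s : T) : Prop :=
  h v s /\
  ((s \notin P /\ rank s < rank v) \/
   (s \in P /\ exists t, [/\ t \in P, t \notin S, h v t & c0 t = c0 s])).

(** With two redundant neighbours, at most [k - 1] of the [k.+1] neighbours of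
    [v] contribute a colour.  The ranks may have ties: what the induction
    maintains is that no uncoloured vertex outranks a coloured one outside
    [P], so a neighbour of strictly smaller rank is still uncoloured. *)
Lemma greedy_colorable (T : finType) (h : rel T) (k : nat) (P : {set T})
    (c0 : T -> 'I_k) (rank : T -> nat) :
  symmetric h -> irreflexive h ->
  (forall v, #|[set w | h v w]| <= k.+1) ->
  {in P &, forall v w, h v w -> c0 v != c0 w} ->
  (forall v, v \notin P -> exists2 S : {set T}, 1 < #|S| &
     {in S, forall s, redundant h P c0 rank v S s}) ->
  colorable h k.
Proof.
move=> hsym hirr hdeg c0P hS.
suff Hn n : n <= #|~: P| -> exists C : {set T}, exists c : T -> 'I_k,
    [/\ P \subset C, #|C :\: P| = n,
        {in P, c =1 c0}, {in C &, forall v w, h v w -> c v != c w} &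
        forall x y, x \in C :\: P -> y \notin C -> rank y <= rank x].
  have [C [c [PC cardC _ cC _]]] := Hn _ (leqnn _).
  have CT x : x \in C.
    have: C :\: P == ~: P by rewrite eqEcard cardC leqnn setDE subsetIr.
    move=> /eqP E; case: (boolP (x \in P)) => [/(subsetP PC)//|xP].
    by move/setP: E => /(_ x); rewrite !inE xP.
  apply/existsP; exists [ffun x => c x].
  by apply/forallP => x; apply/forallP => y; apply/implyP; rewrite !ffunE; apply: cC.
elim: n => [_|n IHn ltn].
  by exists P, c0; split=> //; [rewrite setDv cards0|move=> x y; rewrite setDv inE].
have [C [c [PC cardC cP cC Cup]]] := IHn (ltnW ltn).
have [v0 v0C] : exists v, v \in ~: C.
  apply/set0Pn/eqP => C0; suff: #|~: P| <= #|C :\: P| by rewrite cardC leqNgt ltn.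
  apply: subset_leq_card; apply/subsetP => x; rewrite !inE => ->.
  by move/setP: C0 => /(_ x); rewrite !inE => /negbFE ->.
case: (arg_maxnP (P := [in ~: C]) rank v0C) => v; rewrite !inE => vC vmax.
have vP : v \notin P by apply: contra vC; apply: (subsetP PC).
have [S S2 HS] := hS v vP.
have SN : S \subset [set w | h v w].
  by apply/subsetP => s /HS[hs _]; rewrite inE.
(* The neighbours outside S carry fewer than k colours. *)
have [a aF] : exists a, a \notin c @: ([set w | h v w] :\: S).
  suff: 0 < #|~: (c @: ([set w | h v w] :\: S))|.
    by case/card_gt0P => a; rewrite inE; exists a.
  have SleN : #|S| <= #|[set w | h v w]| by apply: subset_leq_card.
  rewrite cardsCs setCK card_ord subn_gt0.
  apply: leq_ltn_trans (leq_imset_card _ _) _; rewrite cardsDS //.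
  by move: (hdeg v) S2 SleN; case: #|_| => [|m]; case: #|S| => [|l] //; lia.
have aC w : w \in C -> h v w -> c w != a.
  move=> wC hvw; apply: contraNneq aF => <-.
  case: (boolP (w \in S)) => [wS|wS]; last by rewrite imset_f // !inE wS.
  have [_ [[wP lt]|[wP [t [tP tS hvt ct]]]]] := HS w wS.
    have := Cup w v; rewrite !inE wP wC => /(_ isT vC).
    by rewrite leqNgt lt.
  by rewrite (cP _ wP) -ct -(cP _ tP) imset_f // !inE tS.
exists (v |: C), (fun w => if w == v then a else c w); split.
- exact: subset_trans PC (subsetUr _ _).
- rewrite setDUl (_ : [set v] :\: P = [set v]) ?cardsU1 ?cardC ?inE ?(negPf vC) ?andbF //.
  by apply/setP => x; rewrite !inE; case: eqVneq => [->|]; rewrite ?vP ?andbF.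
- by move=> x xP /=; case: eqVneq => [xv|_]; [rewrite xv (negPf vP) in xP | apply: cP].
- move=> x y; rewrite !inE.
  case: (eqVneq x v) => [->|_] /=; case: (eqVneq y v) => [->|_] //=; rewrite ?hirr //.
  + by move=> _ yC hvy; rewrite eq_sym aC.
  + by move=> xC _; rewrite hsym => /aC; apply.
  + exact: cC.
- move=> x y; rewrite !inE negb_or => /andP[xP /predU1P[->|xC]] /andP[_ yC].
    by apply: vmax; rewrite !inE.
  by apply: Cup => //; rewrite !inE xP.
Qed.

(** The minimum defining the chromatic number only ranges over [k <= #|T|];
    larger values of [k] are above the minimum in any case. *)
Lemma chromatic_number_le (T : finType) (h : rel T) k :
  colorable h k -> chromatic_number h <= k.
Proof.
move=> hk; rewrite /chromatic_number.
case: (ltnP k #|T|.+1) => kT; last first.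
  by case: ([arg min_(_ < _ | _) _]) => i /= /ltnW i_lt; apply: leq_trans kT.
have hT : colorable h (ord_max : 'I_#|T|.+1).
  have /existsP[f /forallP hf] := hk.
  apply/existsP; exists [ffun x => widen_ord (kT : k <= #|T|) (f x)].
  apply/forallP => x; apply/forallP => y; apply/implyP => hxy.
  by rewrite !ffunE -val_eqE /=; move: (hf x) => /forallP/(_ y); rewrite hxy.
by case: arg_minnP => // i _ /(_ (Ordinal kT) hk).
Qed.

(** * Walks, distances and short cycles *)

Definition within (T : finType) (e : rel T) n x y :=
  enat_le (gdist e x y) (Some n).

Section Walks.
Variables (T : finType) (e : rel T).
Hypotheses (e_sym : symmetric e) (e_irr : irreflexive e).

(** The search in [gdist] stops at [#|T|], so a walk has to be shortened to a
    path before it is known to be found. *)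
Lemma withinP n x y :
  reflect (exists p, [/\ path e x p, last x p = y & size p <= n])
          (within e n x y).
Proof.
apply: (iffP idP) => [/least_upto_witness[k kn]|[p [xp <- pn]]].
  case/existsP => p /andP[xp /eqP xy]; exists p; split=> //.
  by rewrite size_tuple.
case/shortenP: xp => q xq uq sub.
have qp : size q <= size p by apply: uniq_leq_size sub; case/andP: uq.
have qT : size q <= #|T|.
  by have := max_card [in x :: q]; rewrite (card_uniqP uq) => /ltnW.
have: enat_le (gdist e x (last x q)) (Some (size q)).
  apply: least_upto_le => //; apply/existsP; exists (in_tuple q).
  by rewrite xq eqxx.
rewrite /within; case: gdist => //= d dq.
exact: leq_trans dq (leq_trans qp pn).
Qed.
Lemma within_refl n x : within e n x x.
Proof. by apply/withinP; exists [::]. Qed.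

Lemma within_edge x y : e x y -> within e 1 x y.
Proof. by move=> exy; apply/withinP; exists [:: y]; rewrite /= exy. Qed.

Lemma within_leq m n x y : m <= n -> within e m x y -> within e n x y.
Proof.
move=> mn /withinP[p [xp xy pm]]; apply/withinP; exists p.
by split=> //; apply: leq_trans mn.
Qed.

Lemma within_trans m n x y z :
  within e m x y -> within e n y z -> within e (m + n) x z.
Proof.
move=> /withinP[p [xp xy pm]] /withinP[q [yq yz qn]].
apply/withinP; exists (p ++ q).
by rewrite cat_path xp xy yq last_cat xy yz size_cat leq_add.
Qed.

Lemma path_rev x p : path e x p -> path e (last x p) (rev (belast x p)).
Proof. by rewrite rev_path (eq_path (e' := e)) // => y z; rewrite e_sym. Qed.

Lemma within_sym n x y : within e n x y = within e n y x.
Proof.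
suff W u v : within e n u v -> within e n v u by apply/idP/idP; apply: W.
move=> /withinP[p [up <- pn]]; apply/withinP; exists (rev (belast u p)).
rewrite path_rev // size_rev size_belast; split=> //.
by case: (p) => //= w q; rewrite rev_cons last_rcons.
Qed.

Lemma within_path n x p : path e x p -> size p <= n -> within e n x (last x p).
Proof. by move=> xp pn; apply/withinP; exists p. Qed.

(** [ucycle] also holds of a single edge run back and forth and of the empty
    sequence; the size condition leaves the genuine cycles. *)
Definition long_cycles L := forall c, ucycle e c -> 2 < size c -> L < size c.

Lemma girth_long_cycles L : enat_lt (Some L) (girth e) -> long_cycles L.
Proof.
move=> gL c cc c3.
have cT : size c <= #|T|.
  by have /andP[_ uc] := cc; rewrite -(card_uniqP uc) max_card.
have: enat_le (girth e) (Some (size c)).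
  apply: least_upto_le => //; rewrite /cycle_of_length c3.
  by apply/existsP; exists (in_tuple c).
move: gL; rewrite /enat_lt; case: (girth e) => //= g.
by rewrite -ltnNge; apply: leq_trans.
Qed.

Lemma last_uniq_nil (x : T) p : uniq (x :: p) -> last x p = x -> p = [::].
Proof. by case: p => //= y p /andP[xyp _] E; rewrite -E mem_last in xyp. Qed.

(** A ball of small radius is a tree: two distinct paths with the same ends
    contain two paths that meet only at their ends, which together form a
    cycle.  If the given paths share an inner vertex, both halves are equal
    by induction. *)
Lemma short_path_unique L x p q :
  long_cycles L -> size p + size q <= L ->
  path e x p -> path e x q -> uniq (x :: p) -> uniq (x :: q) ->
  last x p = last x q -> p = q.
Proof.
move=> hL; have [n] := ubnP (size p + size q).
elim: n x p q => // n IH x p q pqn pqL.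
case: (lastP p) pqn pqL => [|p1 y] pqn pqL.
  by move=> _ _ _ uq /esym/(last_uniq_nil uq).
case: (lastP q) pqn pqL => [|q1 y'] pqn pqL.
  by move=> _ _ up _ /(last_uniq_nil up).
rewrite !last_rcons => xp xq up uq yy'; subst y'.
case: (boolP (has (mem q1) p1)) => [/hasP[z zp zq]|].
  move: zp zq xp xq up uq pqn pqL => /splitPr[p11 p12] /splitPr[q11 q12].
  rewrite !rcons_cat !rcons_cons -!cat_rcons -!cat_cons.
  rewrite !cat_path !last_rcons !cat_uniq !size_cat !size_rcons.
  move=> /andP[xp1 zp2] /andP[xq1 zq2] /and3P[up1 hp up2] /and3P[uq1 hq uq2].
  move=> pqn pqL.
  have up2' : uniq (z :: rcons p12 y).
    rewrite cons_uniq up2 andbT; apply: contraNN hp => zp; apply/hasP; exists z => //.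
    by rewrite /= inE mem_rcons mem_head orbT.
  have uq2' : uniq (z :: rcons q12 y).
    rewrite cons_uniq uq2 andbT; apply: contraNN hq => zp; apply/hasP; exists z => //.
    by rewrite /= inE mem_rcons mem_head orbT.
  rewrite (IH x (rcons p11 z) (rcons q11 z)) ?last_rcons ?size_rcons //;
    try by move: pqn pqL; clear; lia.
  by rewrite (IH z (rcons p12 y) (rcons q12 y)) ?last_rcons ?size_rcons //;
    move: pqn pqL; clear; lia.
move=> disj.
case: (leqP (size p1 + size q1).+2 2) => [small|big].
  by case: (p1) small => [|? ?]; case: (q1) => [|? ?] //=; rewrite ?addnS.
pose c := x :: p1 ++ y :: rev q1.
suff cc : ucycle e c.
  have := hL c cc; rewrite /c /= size_cat /= size_rev.
  by move: pqL big; rewrite !size_rcons; clear; lia.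
have yq : path e y (rcons (rev q1) x).
  by move: (path_rev xq); rewrite last_rcons belast_rcons rev_cons.
have -> : ucycle e c = cycle e c && uniq c :> Prop by [].
rewrite /c [cycle _ _]/= rcons_cat rcons_cons cat_path [path e (last _ _) _]/= yq.
move: xp; rewrite rcons_path => /andP[-> ->] /=.
rewrite -cat_rcons.
move: up uq; rewrite /= !rcons_uniq cat_uniq mem_cat !mem_rcons !inE !negb_or.
move=> /and3P[/andP[-> xp1] yp1 up1] /and3P[/andP[_ xq1] yq1 uq1].
rewrite xp1 mem_rev xq1 rcons_uniq yp1 up1 rev_uniq uq1 /=.
rewrite andbT; apply/hasPn => z; rewrite mem_rev mem_rcons inE => zq.
rewrite negb_or (contraNneq _ yq1) => [|<- //]; apply: contraNN disj => zp.
by apply/hasP; exists z.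
Qed.

(** A walk of length at most [n] between the ends would contain a path, which
    short cycles being excluded would have to be the path [p] itself. *)
Lemma far_ends L n x p :
  long_cycles L -> path e x p -> uniq (x :: p) -> n < size p ->
  size p + n <= L -> ~~ within e n x (last x p).
Proof.
move=> hL xp up np pnL; apply/withinP => -[q [xq xy qn]].
case/shortenP: xq xy => q' xq' uq' sub xy.
have q'q : size q' <= size q by apply: uniq_leq_size sub; case/andP: uq'.
have pq : size p + size q' <= L by apply: leq_trans pnL; rewrite leq_add2l (leq_trans q'q).
have E : p = q' by apply: (short_path_unique hL pq xp xq').

by move: np; rewrite ltnNge E (leq_trans q'q).
Qed.

(** A path that does not turn back at its first vertex cannot close up before
    its length reaches that of a shortest cycle. *)
Lemma extend_path L x y p :
  long_cycles L -> (size p).+1 <= L -> path e y p -> uniq (y :: p) ->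
  e x y -> x != head y p -> uniq (x :: y :: p).
Proof.
move=> hL pL yp up exy xh; rewrite cons_uniq up andbT inE negb_or.
apply/andP; split; first by apply: contraTneq exy => ->; rewrite e_irr.
apply/negP => xp; case/splitPr: p / xp pL yp up xh => p1 p2 pL yp up xh.
have E : rcons p1 x = [:: x].
  apply: (@short_path_unique L y) => //=.
  - by move: pL; rewrite size_rcons size_cat /=; clear; lia.
  - by move: yp; rewrite -cat_rcons cat_path => /andP[].
  - by rewrite e_sym exy.
  - by move: up; rewrite -cat_rcons -cat_cons cat_uniq => /andP[].
  - by rewrite inE andbT; apply: contraTneq exy => ->; rewrite e_irr.
  - by rewrite last_rcons.
by case: p1 E xh {pL yp up} => [|? []] //= _; rewrite eqxx.
Qed.

Lemma uniq_path_exists L n (x0 : T) :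
  long_cycles L -> n <= L -> (forall y z, exists2 x, e x y & x != z) ->
  exists x p, [/\ path e x p, uniq (x :: p) & size p = n].
Proof.
move=> hL + deg; elim: n => [|n IH] nL; first by exists x0, [::].
have [y [p [yp up pn]]] := IH (ltnW nL).
have [x exy xh] := deg y (head y p).
exists x, (y :: p); split; last by rewrite /= pn.
  by rewrite /= exy.
by apply: (extend_path hL); rewrite ?pn.
Qed.

Lemma within_step n x y : within e n.+1 x y -> ~~ within e n x y ->
  exists2 z, within e n x z & e z y.
Proof.
move=> /withinP[p [xp xy pn]] far; case: (lastP p) xp xy pn => [|q w].
  by move=> _ xy; rewrite -xy within_refl in far.
rewrite rcons_path last_rcons size_rcons => /andP[xq ew] <- qn.
by exists (last x q) => //; apply: within_path.
Qed.

(** Every vertex of the sphere of radius [n.+1 > 0] has a neighbour closer to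
    the centre, hence at most [Delta.-1] neighbours on the next sphere. *)
Lemma sphere_bound Delta n x :
  (forall y, #|[set z | e y z]| <= Delta) ->
  #|[set y | within e n.+1 x y] :\: [set y | within e n x y]|
    <= Delta * Delta.-1 ^ n.
Proof.
move=> hD; elim: n => [|n IH].
  rewrite muln1; apply: leq_trans (hD x); apply: subset_leq_card.
  apply/subsetP => y; rewrite !inE => /andP[far near].
  have [z /withinP[[|? ?] [_ /= <- //]]] := within_step near far.
pose S := [set y | within e n.+1 x y] :\: [set y | within e n x y].
have sub : [set y | within e n.+2 x y] :\: [set y | within e n.+1 x y]
    \subset \bigcup_(z in S) ([set y | e z y] :\: [set y | within e n.+1 x y]).
  apply/subsetP => y; rewrite !inE => /andP[far near].
  have [z zn ezy] := within_step near far.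
  apply/bigcupP; exists z; rewrite !inE ?zn ?far ?ezy //= andbT.
  apply: contraNN far => zn'.
  by rewrite -addn1; apply: within_trans zn' (within_edge ezy).
apply: leq_trans (subset_leq_card sub) _.
apply: leq_trans (_ : \sum_(z in S) Delta.-1 <= _); last first.
  by rewrite sum_nat_const expnSr mulnA leq_mul2r IH orbT.
elim/big_rec2: _ => [|z m A]; first by rewrite cards0.
rewrite !inE => /andP[far near] Am; apply: leq_trans (leq_card_setU _ _) _.
apply: leq_add Am.
have [w wn ewz] := within_step near far.
rewrite cardsD -ltnS; apply: leq_trans (_ : #|[set y | e z y]| <= _).
  have: 0 < #|[set y | e z y] :&: [set y | within e n.+1 x y]|.
    apply/card_gt0P; exists w; rewrite !inE e_sym ewz /=.
    exact: within_leq wn.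
  have: 0 < #|[set y | e z y]| by apply/card_gt0P; exists w; rewrite inE e_sym.
  by clear; lia.
by apply: leq_trans (hD z) _; apply: leqSpred.
Qed.

Lemma ball_bound Delta n x :
  (forall y, #|[set z | e y z]| <= Delta) ->
  #|[set y | within e n x y]| <= (\sum_(i < n) Delta * Delta.-1 ^ i).+1.
Proof.
move=> hD; elim: n => [|n IH].
  rewrite big_ord0 -(cards1 x); apply: subset_leq_card; apply/subsetP => y.
  by rewrite !inE => /withinP[[|? ?] [_ /= <- //]].
rewrite big_ord_recr /= -addSn -(cardsID [set y | within e n x y]).
apply: leq_add (sphere_bound n x hD); apply: leq_trans IH.
by apply: subset_leq_card; apply: subsetIr.
Qed.

Lemma power_degree_bound Delta n x :
  (forall y, #|[set z | e y z]| <= Delta) ->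
  #|[set y | graph_power e n x y]| <= \sum_(i < n) Delta * Delta.-1 ^ i.
Proof.
move=> hD; rewrite -ltnS; apply: leq_trans (ball_bound n x hD).
apply: proper_card; apply/properP; split.
  by apply/subsetP => y; rewrite !inE => /andP[].
exists x; first by rewrite inE within_refl.
by rewrite inE /graph_power /= eqxx.
Qed.

End Walks.

(** The function [d] is the distance to [r]; only its descent along edges is
    recorded, since it is used as a colouring order. *)
Lemma distance_to_root (T : finType) (e : rel T) (r : T) :
  exists d : T -> nat, forall v, connect e v r -> v != r ->
    exists w, [/\ e v w, connect e w r & d v = (d w).+1].
Proof.
pose W v n := walk_of_length e v r n.
have walkE v p : path e v p -> last v p = r -> W v (size p).
  by move=> vp vr; apply/existsP; exists (in_tuple p); rewrite vp vr eqxx.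
have [d dP] : exists d : T -> nat, forall v, connect e v r ->
    W v (d v) /\ forall n, W v n -> d v <= n.
  apply: (@fin_all_exists _ _ (fun v n => connect e v r ->
    W v n /\ forall m, W v m -> n <= m)) => v.
  case: (boolP (connect e v r)) => [/connectP[p vp rp]|_]; last by exists 0.
  have ex : exists n, W v n by exists (size p); apply: walkE.
  by case: (ex_minnP ex) => n Wn nmin; exists n.
exists d => v vr vNr.
have [/existsP[[p /= /eqP pd] /andP[vp /eqP rp]] dmin] := dP v vr.
case: p vp rp pd => [_ /= E|w p /= /andP[evw wp] rp pd].
  by rewrite E eqxx in vNr.
have wr : connect e w r by apply/connectP; exists p.
exists w; split=> //; rewrite -pd.
have [/existsP[[q /= /eqP qd] /andP[wq /eqP rq]] wmin] := dP w wr.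
apply/eqP; rewrite eqSS eqn_leq wmin ?andbT; last exact: walkE.
rewrite -ltnS [(size p).+1]pd -qd -[(size q).+1]/(size (w :: q)).
by apply: dmin; apply: walkE; rewrite //= evw.
Qed.

(** * Connectivity *)

Section Connectivity.
Variables (T : finType) (e : rel T).
Hypotheses (e_sym : symmetric e) (e_irr : irreflexive e).

Lemma k_connected_leq k l : k <= l -> k_connected e l -> k_connected e k.
Proof.
move=> kl /andP[lT /forallP H]; rewrite /k_connected (leq_ltn_trans kl lT).
apply/forallP => X; apply/implyP => Xk.
by move: (H X); rewrite (leq_trans Xk kl).
Qed.

Lemma connectivity_k_connected k :
  0 < k -> k <= connectivity e -> k_connected e k.
Proof.
case: k => // k _; apply: contraTT => notk; rewrite -ltnNge ltnS.
apply/bigmax_leqP => i ci; rewrite leqNgt; apply: contra notk => ki.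
exact: k_connected_leq ci.
Qed.

Lemma k_connectedP k (X : {set T}) x y :
  k_connected e k -> #|X| < k -> x \notin X -> y \notin X ->
  connect (del_vertices e X) x y.
Proof.
move=> /andP[_ /forallP/(_ X)/implyP H] Xk xX yX.
have /forall_inP/(_ x) := H Xk; rewrite inE => /(_ xX)/forall_inP/(_ y).
by rewrite inE => /(_ yX).
Qed.

(** If [x] had fewer than [k] neighbours, deleting them all would isolate [x]
    from some other vertex, as there are more than [k] vertices. *)
Lemma k_connected_min_degree k x : k_connected e k -> k <= #|[set y | e x y]|.
Proof.
move=> ck; rewrite leqNgt; apply/negP => small.
have xN : x \notin [set y | e x y] by rewrite inE e_irr.
have [y] : exists y, y \notin x |: [set y | e x y].
  suff: 0 < #|~: (x |: [set y | e x y])|.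
    by case/card_gt0P => y; rewrite inE; exists y.
  rewrite cardsCs setCK cardsU1 xN subn_gt0.
  by have /andP[kT _] := ck; apply: leq_ltn_trans kT.
rewrite in_setU1 negb_or => /andP[yx yN].
have /connectP[[|z p] /=] := k_connectedP ck small xN yN.
  by move=> _ E; rewrite E eqxx in yx.
by rewrite /del_vertices /= inE => /andP[/and3P[_ /negP zN exz]]; case: zN; rewrite inE.
Qed.

End Connectivity.

(** * Colouring a power from a precoloured configuration *)

(** The set [X] is deleted to measure distances, while [P] is precoloured.  A
    vertex on a shortest path to [r] may thus be precoloured when it lies in
    [P :\: X], and is then not coloured later.  The second alternative on
    [P :\: X] makes such vertices so sparse that two of the next three
    vertices on the path remain, all three being within distance [g >= 3].
    The pair [a1], [a2] serves [u], and the set [S] serves [r]. *)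
Lemma power_colorable_from_root (T : finType) (e : rel T) (g k : nat)
    (X P : {set T}) (c0 : T -> 'I_k) (r u a1 a2 : T) (S : {set T}) :
  symmetric e -> irreflexive e -> 2 <= g ->
  (forall v, #|[set w | graph_power e g v w]| <= k.+1) ->
  {in P &, forall v w, graph_power e g v w -> c0 v != c0 w} ->
  (forall v w, v \notin X -> w \notin X -> connect (del_vertices e X) v w) ->
  P \subset X \/
    (3 <= g /\ {in P :\: X &, forall x y, x != y -> ~~ within e 2 x y}) ->
  r \notin P -> u \notin P -> X \subset P -> e r u ->
  [/\ a1 \in P, a2 \in P, a1 != a2 & c0 a1 = c0 a2] ->
  within e g u a1 -> within e g u a2 ->
  1 < #|S| ->
  {in S, forall s, [/\ s \in P, within e g r s & exists t,
     [/\ t \in P, t \notin S, within e g r t & c0 t = c0 s]]} ->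
  colorable (graph_power e g) k.
Proof.
move=> e_sym e_irr g2 deg c0P conn sparse rP uP XP eru [a1P a2P a12 ca12].
move=> ua1 ua2 S2 HS.
have pow v w : v != w -> within e g v w -> graph_power e g v w.
  by move=> vw near; rewrite /graph_power /= vw.
have powX m v w : m <= g -> v != w -> within e m v w -> graph_power e g v w.
  by move=> mg vw /(within_leq mg); apply: pow.
have offP v s : v \notin P -> s \in P -> v != s.
  by move=> vP sP; apply: contraNneq vP => ->.
have ru : r != u by apply: contraTneq eru => ->; rewrite e_irr.
have [d dP] := distance_to_root (del_vertices e X) r.
have rX : r \notin X by apply: contra rP; apply: (subsetP XP).
pose rank v := if v == r then 0 else if v == u then 1 else (d v).+1.
have step v : v \notin X -> v != r ->
    exists w, [/\ e v w, w \notin X & d v = (d w).+1].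
  move=> vX vr; have [w [/and3P[_ wX evw] _ dvw]] := dP v (conn v r vX rX) vr.
  by exists w.
have rank_lt v w : v != r -> v != u -> d w < d v -> rank w < rank v.
  rewrite /rank => /negPf-> /negPf-> dwv.
  by case: (w == r) => //; case: (w == u) => //; apply: (leq_ltn_trans (leq0n (d w)) dwv).
apply: (greedy_colorable (P := P) (c0 := c0) (rank := rank)) => //.
- by move=> v w; rewrite /graph_power /= eq_sym; congr (_ && _); apply: within_sym.
- by move=> v; rewrite /graph_power /= eqxx.
move=> v vP.
have vX : v \notin X by apply: contra vP; apply: (subsetP XP).
(* Two neighbours of smaller rank are all that an ordinary vertex needs. *)
have later w1 w2 : w1 != w2 -> w1 \notin P -> w2 \notin P ->
    graph_power e g v w1 -> graph_power e g v w2 ->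
    rank w1 < rank v -> rank w2 < rank v ->
    exists2 S0 : {set T}, 1 < #|S0| &
      {in S0, forall s, redundant (graph_power e g) P c0 rank v S0 s}.
  move=> w12 w1P w2P hw1 hw2 lt1 lt2; exists [set w1; w2]; first by rewrite cards2 w12.
  by move=> s; rewrite !inE => /pred2P[]->; split=> //; left.
case: (eqVneq v r) => [vr|vr].
  exists S => // s /HS[sP near [t [tP tS near' ct]]]; subst v; split.
    by apply: pow => //; apply: offP.
  by right; split=> //; exists t; split=> //; apply: pow => //; apply: offP.
case: (eqVneq v u) => [vu|vu].
  subst v; exists [set r; a2]; first by rewrite cards2 offP.
  move=> s; rewrite !inE => /pred2P[]->; split.
  - by apply: (powX 1); [exact: ltnW | | apply: within_edge; rewrite e_sym].
  - by left; rewrite /rank eqxx eq_sym (negPf ru) eqxx.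
  - by apply: pow => //; apply: offP.
  - right; split=> //; exists a1; split=> //; last by apply: pow => //; apply: offP.
    by rewrite !inE negb_or a12 andbT eq_sym offP.
(* A vertex at distance m < g from r has both r and u within distance g. *)
have near_root m : m <= 2 -> m < g -> within e m v r ->
    exists2 S0 : {set T}, 1 < #|S0| &
      {in S0, forall s, redundant (graph_power e g) P c0 rank v S0 s}.
  move=> m2 mg near; apply: (later r u) => //.
  - exact: powX (ltnW mg) vr near.
  - by apply: (powX m.+1) => //; rewrite -addn1; apply: within_trans near (within_edge eru).
  - by rewrite /rank eqxx (negPf vr) (negPf vu).
  - rewrite /rank eqxx eq_sym (negPf ru) (negPf vr) (negPf vu) ltnS.
    by have [w [_ _ ->]] := step v vX vr.
have [p1 [e1 p1X d1]] := step v vX vr.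
case: (eqVneq p1 r) => [p1r|p1r].
  by apply: (near_root 1) => //; apply: within_edge; rewrite -p1r.
have [p2 [e2 p2X d2]] := step p1 p1X p1r.
have near2 : within e 2 v p2 by apply: (within_trans (m := 1) (n := 1)) (within_edge e1) (within_edge e2).
have neq w w' : d w < d w' -> w' != w by apply: contraTneq => ->; rewrite ltnn.
have lt1 : d p1 < d v by rewrite d1.
have lt12 : d p2 < d p1 by rewrite d2.
have lt2 := ltn_trans lt12 lt1.
have h1 : graph_power e g v p1.
  by apply: (powX 1); [exact: ltnW | apply: neq | apply: within_edge].
have h2 : graph_power e g v p2 by apply: (powX 2) => //; apply: neq.
have l1 : rank p1 < rank v by apply: rank_lt.
have l2 : rank p2 < rank v by apply: rank_lt.
case: (boolP ((p1 \notin P) && (p2 \notin P))) => [/andP[p1P p2P]|].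
  by apply: (later p1 p2) => //; apply: neq.
rewrite negb_and !negbK => bad.
case: sparse => [/subsetP PX|[g3 far]].
  by case/orP: bad => /PX; rewrite ?(negPf p1X) ?(negPf p2X).
case: (eqVneq p2 r) => [p2r|p2r].
  by apply: (near_root 2) => //; rewrite -p2r.
have [p3 [e3 p3X d3]] := step p2 p2X p2r.
have lt23 : d p3 < d p2 by rewrite d3.
have lt13 := ltn_trans lt23 lt12.
have lt3 := ltn_trans lt23 lt2.
have apart x y : x \notin X -> y \notin X -> d y < d x -> within e 2 x y ->
    x \in P -> y \notin P.
  move=> xX yX lt near xP; apply/negP => yP.
  by have := far x y; rewrite !inE xX yX xP yP near => /(_ isT isT (neq _ _ lt)).
have w12 : within e 2 p1 p2 by apply: within_leq (within_edge e2).
have w23 : within e 2 p2 p3 by apply: within_leq (within_edge e3).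
have w13 : within e 2 p1 p3 by apply: (within_trans (m := 1) (n := 1)) (within_edge e2) (within_edge e3).
have h3 : graph_power e g v p3.
  apply: (powX 3) => //; first exact: neq.
  exact: (within_trans (m := 2) (n := 1)) near2 (within_edge e3).
have l3 : rank p3 < rank v by apply: rank_lt.
case: (boolP (p1 \in P)) => p1P.
  have p2P : p2 \notin P by apply: (apart p1) => //.
  have p3P : p3 \notin P by apply: (apart p1) => //.
  by apply: (later p2 p3) => //; apply: neq.
rewrite (negPf p1P) /= in bad.
have p3P : p3 \notin P by apply: (apart p2) => //.
by apply: (later p1 p3) => //; apply: neq.
Qed.

Section Configurations.
Variables (T : finType) (e : rel T) (g k : nat).
Hypotheses (e_sym : symmetric e) (e_irr : irreflexive e).
Hypothesis deg : forall v, #|[set w | graph_power e g v w]| <= k.+1.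
Hypothesis mindeg : forall x : T, 3 <= #|[set y | e x y]|.

Lemma third_neighbour x y z : exists w, [/\ e x w, w != y & w != z].
Proof.
have: 0 < #|[set w | e x w] :\: [set y; z]|.
  rewrite cardsD subn_gt0; apply: leq_trans (mindeg x).
  apply: leq_ltn_trans (subset_leq_card (subsetIr _ _)) _.
  by rewrite cards2; case: (_ != _).
by case/card_gt0P => w; rewrite !inE negb_or => /andP[/andP[? ?] ?]; exists w.
Qed.

Lemma neighbour_neq x y : e x y -> x != y.
Proof. by apply: contraTneq => ->; rewrite e_irr. Qed.

Lemma far_neq n x y : ~~ within e n x y -> x != y.
Proof. by apply: contraNneq => ->; apply: within_refl. Qed.

Lemma far_not_adjacent x y : ~~ within e g x y -> graph_power e g x y = false.
Proof. by move=> /negPf xy; rewrite /graph_power /= [enat_le _ _]xy andbF. Qed.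

(** The paths [a1 r u a2], [a1 r w a3] and [a2 u r w a3] have lengths 3, 3 and
    4; with cycles longer than 6 their ends are at distance more than 2. *)
Lemma square_colorable (r : T) : g = 2 -> 0 < k -> long_cycles e 6 ->
  k_connected e 4 -> colorable (graph_power e g) k.
Proof.
move=> g2 k0 hL conn; have far_g := far_ends e_sym hL (n := g).
have [a1 [ra1 _ _]] := third_neighbour r r r.
have [u [ru ua1 _]] := third_neighbour r a1 a1.
have [w [rw wa1 wu]] := third_neighbour r a1 u.
have [a2 [ua2 a2r _]] := third_neighbour u r r.
have [a3 [wa3 a3r _]] := third_neighbour w r r.
have ext := extend_path e_sym e_irr hL.
have ur : e u r by rewrite e_sym.
have a1r : e a1 r by rewrite e_sym.
have a2u : e a2 u by rewrite e_sym.
have [P2 U2] : path e r [:: u; a2] /\ uniq [:: r; u; a2].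
  by rewrite /= ru ua2 !inE negb_or (neighbour_neq ru) (neighbour_neq ua2) eq_sym a2r.
have [P3 U3] : path e r [:: w; a3] /\ uniq [:: r; w; a3].
  by rewrite /= rw wa3 !inE negb_or (neighbour_neq rw) (neighbour_neq wa3) eq_sym a3r.
have U12 : uniq [:: a1; r; u; a2] by apply: ext; rewrite //= eq_sym.
have U13 : uniq [:: a1; r; w; a3] by apply: ext; rewrite //= eq_sym.
have U03 : uniq [:: u; r; w; a3] by apply: ext; rewrite //= eq_sym.
have P03 : path e u [:: r; w; a3] by rewrite /= ur.
have U23 : uniq [:: a2; u; r; w; a3] by apply: ext.
have F12 : ~~ within e g a1 a2.
  by apply: (far_g a1 [:: r; u; a2]); rewrite ?g2 //= a1r.
have F13 : ~~ within e g a1 a3.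
  by apply: (far_g a1 [:: r; w; a3]); rewrite ?g2 //= a1r.
have F23 : ~~ within e g a2 a3.
  by apply: (far_g a2 [:: u; r; w; a3]); rewrite ?g2 //= a2u.
have near x y z : e x y -> e y z -> within e g x z.
  move=> xy yz; rewrite g2.
  exact: (within_trans (m := 1) (n := 1)) (within_edge xy) (within_edge yz).
have near1 x y : e x y -> within e g x y.
  by move=> /within_edge; apply: within_leq; rewrite g2.
pose P := [set a1; a2; a3].
have P_le3 : #|P| < 4.
  rewrite /P !ltnS; apply: leq_trans (leq_card_setU _ _) _.
  by rewrite cards1 addn1 ltnS cards2; case: (_ != _).
apply: (power_colorable_from_root (X := P) (P := P) (c0 := fun=> Ordinal k0)
  (r := r) (u := u) (a1 := a1) (a2 := a2) (S := [set a2; a3])) => //.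
- by rewrite g2.
- have far_sym x y : ~~ within e g x y -> graph_power e g y x = false.
    by rewrite (within_sym e_sym); apply: far_not_adjacent.
  have self x : graph_power e g x x = false by rewrite /graph_power /= eqxx.
  move=> v z; rewrite !inE => /orP[/orP[]|] /eqP-> /orP[/orP[]|] /eqP->;
    by rewrite ?self ?(far_not_adjacent F12, far_not_adjacent F13,
      far_not_adjacent F23, far_sym _ _ F12, far_sym _ _ F13, far_sym _ _ F23).
- by move=> v z; apply: (k_connectedP conn).
- by left.
- by rewrite !inE !negb_or neighbour_neq //= ![r == _]eq_sym a2r a3r.
- rewrite !inE !negb_or ua1 (neighbour_neq ua2) /=.
  by move: U03; rewrite /= !inE !negb_or => /and4P[/and3P[]].
- by split=> //; rewrite ?(far_neq F12) // !inE eqxx ?orbT.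
- exact: near ur ra1.
- exact: near1.
- by rewrite cards2 (far_neq F23).
have a1S : a1 \notin [set a2; a3].
  by rewrite !inE negb_or (far_neq F12) (far_neq F13).
have a1P : a1 \in P by rewrite !inE eqxx.
move=> s; rewrite !inE => /pred2P[]->; split; rewrite ?eqxx ?orbT //.
- exact: near ru ua2.
- by exists a1; split=> //; apply: near1.
- exact: near rw wa3.
- by exists a1; split=> //; apply: near1.
Qed.

(** The paths [a1 u r w ... a2] and [x r w ... b2] have length [g + 1], so that
    each of the two pairs of ends may share a colour.  The four ends are
    within distance [g] of [r], and [a1], [a2] also within distance [g] of
    [u]. *)
Lemma power_colorable (x0 : T) : 3 <= g -> 1 < k -> long_cycles e (2 * g).+1 ->
  k_connected e 3 -> colorable (graph_power e g) k.
Proof.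
move=> g3 k1 hL conn; have far_g := far_ends e_sym hL (n := g).
have ext := extend_path e_sym e_irr hL.
have gL : g <= (2 * g).+1 by clear; lia.
have deg2 (y z : T) : exists2 x, e x y & x != z.
  by have [x [yx xz _]] := third_neighbour y z z; exists x; rewrite 1?e_sym.
have [r [p [rp rpU pg]]] := uniq_path_exists e_sym e_irr x0 hL gL deg2.
have [w [p0 [a2 [b2 Ep]]]] : exists w p0 a2 b2,
    p = rcons (rcons (w :: p0) a2) b2.
  move: pg g3; case/lastP: p {rp rpU} => [<- //|p b2].
  rewrite size_rcons; case/lastP: p => [<- //|p a2].
  by rewrite size_rcons; case: p => [<- //|w p0] _ _; exists w, p0, a2, b2.
pose q := rcons (w :: p0) a2.
have qg : (size q).+1 = g by rewrite -pg Ep size_rcons.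
move: rp rpU; rewrite Ep -/q rcons_path -rcons_cons rcons_uniq.
rewrite last_rcons => /andP[rq a2b2] /andP[b2q rqU].
have [u [ru uw _]] := third_neighbour r w w.
have [x [rx xw xu]] := third_neighbour r w u.
have [a1 [ua1 a1r _]] := third_neighbour u r r.
have ur : e u r by rewrite e_sym.
have a1u : e a1 u by rewrite e_sym.
have xr : e x r by rewrite e_sym.
have near1 m y z : 0 < m -> e y z -> within e m y z.
  by move=> m0 /within_edge; apply: within_leq.
have rqb : path e r (rcons q b2) by rewrite rcons_path rq last_rcons.
have rqbU : uniq (r :: rcons q b2) by rewrite -rcons_cons rcons_uniq b2q.
have Uu : uniq (u :: r :: q).
  by apply: ext => //; rewrite qg.
have Ua : uniq [:: a1, u, r & q].
  by apply: ext => //=; rewrite ?ur ?qg //; move: g3; clear; lia.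
have Ub : uniq (x :: r :: rcons q b2).
  by apply: ext => //; rewrite size_rcons qg; move: g3; clear; lia.
have Fa : ~~ within e g a1 a2.
  have := far_g a1 [:: u, r & q]; rewrite /= last_rcons a1u ur; apply=> //.
    by rewrite qg.
  by rewrite qg; clear; lia.
have Fb : ~~ within e g x b2.
  have := far_g x (r :: rcons q b2); rewrite /= last_rcons xr size_rcons qg.
  by apply=> //; clear; lia.
have near_b2 : within e g r b2.
  by have := within_path rqb (n := g); rewrite last_rcons size_rcons qg; apply.
have near_a2 : within e (size q) r a2.
  by have := within_path rq (n := size q); rewrite last_rcons; apply.
have near_a1 : within e 2 r a1.
  exact: (within_trans (m := 1) (n := 1)) (within_edge ru) (within_edge ua1).
have qg' : size q <= g by rewrite -qg.
have g0 : 0 < g by rewrite -qg.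
have g2 : 1 < g by apply: ltnW.
(* The coincidences x = a1, b2 = a1 and u = b2 would each give a walk of
   length at most g from a1 to a2. *)
have x_a1 : x != a1.
  apply: contraNneq Fa => <-; rewrite -qg -add1n.
  exact: within_trans (within_edge xr) near_a2.
have b2_a1 : b2 != a1.
  by apply: contraNneq Fa => <-; apply: near1 => //; rewrite e_sym.
have u_b2 : u != b2.
  apply: contraNneq Fa => ub2; apply: within_leq g2 _.
  have b2a2 : e u a2 by rewrite ub2 e_sym.
  exact: (within_trans (m := 1) (n := 1)) (within_edge a1u) (within_edge b2a2).
have a2q : a2 \in q by rewrite mem_rcons mem_head.
have b2qb : b2 \in rcons q b2 by rewrite mem_rcons mem_head.
have x_a2 : x != a2.
  by apply: contraTneq Ub => ->; rewrite cons_uniq inE mem_rcons inE a2q !orbT.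
have r_a2 : r != a2 by apply: contraTneq rqU => ->; rewrite cons_uniq a2q.
have r_b2 : r != b2 by apply: contraTneq rqbU => ->; rewrite cons_uniq b2qb.
have u_a2 : u != a2 by apply: contraTneq Uu => ->; rewrite cons_uniq inE a2q orbT.
have a2_b2 : a2 != b2 by apply: neighbour_neq.
pose X := [set a1; a2]; pose P := [set a1; a2; x; b2].
have X_lt3 : #|X| < 3 by rewrite cards2; case: (_ != _).
pose c0 v := if v \in X then Ordinal (ltnW k1) else Ordinal k1.
have xX : x \notin X by rewrite !inE negb_or x_a1 x_a2.
have b2X : b2 \notin X by rewrite !inE negb_or b2_a1 eq_sym a2_b2.
have PX v : v \in P -> v \notin X -> v = x \/ v = b2.
  by rewrite !inE -orbA => /orP[->//|/pred2P].
have far_sym y z : ~~ within e g y z -> graph_power e g z y = false.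
  by rewrite (within_sym e_sym); apply: far_not_adjacent.
have self y : graph_power e g y y = false by rewrite /graph_power /= eqxx.
apply: (power_colorable_from_root (X := X) (P := P) (c0 := c0)
  (r := r) (u := u) (a1 := a1) (a2 := a2) (S := [set a2; b2])) => //.
- move=> v z vP zP; rewrite /c0.
  case: (boolP (v \in X)) => vX; case: (boolP (z \in X)) => zX //.
    by move: vX zX; rewrite !inE => /pred2P[]-> /pred2P[]->;
      rewrite ?self ?(far_not_adjacent Fa, far_not_adjacent Fb, far_sym _ _ Fa, far_sym _ _ Fb).
  by have [] := PX v vP vX => ->; have [] := PX z zP zX => ->;
    rewrite ?self ?(far_not_adjacent Fa, far_not_adjacent Fb, far_sym _ _ Fa, far_sym _ _ Fb).
- by move=> v z; apply: (k_connectedP conn).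
- right; split=> // v z; rewrite !in_setD => /andP[vX vP] /andP[zX zP].
  have F2 : ~~ within e 2 x b2 by apply: contra Fb; apply: within_leq.
  by have [] := PX v vP vX => ->; have [] := PX z zP zX => ->;
    rewrite ?eqxx // within_sym.
- by rewrite !inE !negb_or r_a2 r_b2 eq_sym a1r neighbour_neq.
- by rewrite !inE !negb_or u_a2 u_b2 [u == x]eq_sym xu neighbour_neq.
- by apply/subsetP => v; rewrite !inE -!orbA => /orP[] ->; rewrite ?orbT.
- split; rewrite ?inE ?eqxx ?orbT ?(far_neq Fa) //.
  by rewrite /c0 !inE !eqxx orbT.
- exact: near1.
- by rewrite -qg -add1n; apply: within_trans (within_edge ur) near_a2.
- by rewrite cards2 a2_b2.
move=> s; rewrite !inE => /pred2P[]->; split; rewrite ?eqxx ?orbT //.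
- exact: within_leq near_a2.
- exists a1; split; rewrite ?inE ?eqxx // ?negb_or.
  + by rewrite (far_neq Fa) eq_sym b2_a1.
  + exact: within_leq near_a1.
  + by rewrite /c0 !inE !eqxx orbT.
- exists x; split; rewrite ?inE ?eqxx ?orbT // ?negb_or.
  + by rewrite x_a2 (far_neq Fb).
  + exact: near1.
  + by rewrite /c0 (negPf xX) (negPf b2X).
Qed.

End Configurations.

(** * The colour count *)

Lemma moore_bound_rat (Delta n : nat) : 2 < Delta ->
  ((\sum_(i < n) Delta * Delta.-1 ^ i)%:R : rat)%R =
  (Delta%:R * (((Delta%:R - 1) ^+ n - 1) / (Delta%:R - 2)))%R.
Proof.
case: Delta => [|[|D]] // D0; rewrite -big_distrr natrM natr_sum /=.
congr (_ * _)%R.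
have -> : (D.+2%:R - 1 = D.+1%:R :> rat)%R by rewrite -natr1 addrK.
have -> : (D.+2%:R - 2 = D.+1%:R - 1 :> rat)%R.
  by rewrite -natr1 -addrA; congr (_ + _)%R.
rewrite subrX1 mulrAC divff ?mul1r; last first.
  by rewrite -natr1 addrK pnatr_eq0 -lt0n.
by apply: eq_bigr => i _; rewrite natrX.
Qed.

Theorem corollary2p7 (gamma : nat) (hgamma : 2 <= gamma)
    (T : finType) (e : rel T) (hG : simple_graph e)
    (hconn : connected_graph e)
    (Delta : nat) (hDelta : max_degree e = Delta) (hDelta3 : 3 <= Delta)
    (hgirth : enat_le (Some (2 * gamma + 2)) (girth e))
    (M : rat)
    (hM : M = (Delta%:R * (((Delta%:R - 1) ^+ gamma - 1) / (Delta%:R - 2)))%R)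
    (hcase : (3 <= gamma /\ 3 <= connectivity e) \/
             [/\ gamma = 2, 4 <= connectivity e & enat_lt (Some 6) (girth e)]) :
  ((chromatic_power e gamma)%:R <= M - 1)%R.
Proof.
have [e_sym e_irr] := hG.
have /andP[/card_gt0P[x0 _] _] := hconn.
pose m := \sum_(i < gamma) Delta * Delta.-1 ^ i.
have m3 : 2 < m.
  rewrite /m; case: gamma hgamma {hgirth hM hcase m} => // n _.
  by rewrite big_ord_recl muln1; apply: ltn_addr.
have hD y : #|[set z | e y z]| <= Delta.
  by rewrite -hDelta (leq_bigmax_cond (F := fun y => #|[set z | e y z]|)).
have deg v : #|[set w | graph_power e gamma v w]| <= m.-1.+1.
  by rewrite prednK ?(ltnW (ltnW m3)) //; apply: power_degree_bound.
suff col : colorable (graph_power e gamma) m.-1.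
  have := chromatic_number_le col; rewrite hM -moore_bound_rat // -/m.
  rewrite -(ler_nat rat) => /le_trans; apply.
  by rewrite -[in leRHS](prednK (ltnW (ltnW m3))) -natr1 addrK.
have mindeg : 3 <= connectivity e -> forall y, 3 <= #|[set z | e y z]|.
  move=> c3 y; apply: k_connected_min_degree => //.
  exact: connectivity_k_connected.
have long : long_cycles e (2 * gamma).+1.
  apply: girth_long_cycles; move: hgirth; rewrite /enat_lt addn2.
  by case: (girth e) => //= l; rewrite -ltnNge.
case: hcase => [[g3 c3]|[g2 c4 g6]].
  apply: power_colorable => //; try exact: mindeg.
  - by case: (m) m3 => [|[|]].
  - exact: connectivity_k_connected.
have c3 := ltnW c4; apply: square_colorable => //; try exact: mindeg.
- by case: (m) m3 => [|[|]].
- exact: girth_long_cycles.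
- exact: connectivity_k_connected.
Qed.
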